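(* Let $(\mathbf X^{m+1},\mu^{m+1})$, with contact parameters $c_l^{m+1},c_r^{m+1}$, be a solution of the energy-stable method given in the context. Then the scheme is energy stable in the sense that $$W(\mathbf X^{m+1})-W(\mathbf X^m)\le 0,\qquad 0\le m\le M-1.$$
   Context: Notation: $(a,b)^\perp=(b,-a)$; $\mathbb I=[0,1]$ is partitioned uniformly by $\rho_j=jh$, $h=1/N$; $(u,v)=\int_0^1u\cdot v\,d\rho$; $\Delta t_m=t_{m+1}-t_m>0$, $m=0,\dots,M-1$; $K(\mathbb I)$ is the space of continuous functions on $\mathbb I$ that are affine on each $[\rho_{j-1},\rho_j]$. $\eta>0$ and $\sigma\in\mathbb R$ are constants. Substrate: a fixed smooth curve $\hat{\mathbf X}(c)=(\hat x(c),\hat y(c))$ parameterized by arc length $c$, with $\hat x\ge0$. Discrete curves: $\mathbf X^m=(r^m,z^m)\in[K(\mathbb I)]^2$ with $r^m\ge0$, $|\partial_\rho\mathbf X^m|>0$, $\mathbf X^m(0)=\hat{\mathbf X}(c_l^m)$, $\mathbf X^m(1)=\hat{\mathbf X}(c_r^m)$; $\theta^m$ is the piecewise constant tangent angle, $\partial_\rho\mathbf X^m=|\partial_\rho\mathbf X^m|(\cos\theta^m,\sin\theta^m)$. Surface energy: $\gamma$ is a positive, $2\pi$-periodic $C^2$ function with $\gamma(-\theta)=\gamma(\theta)$, and $$\mathbf B(\theta)=\begin{pmatrix}\gamma(\theta)&-\gamma'(\theta)\\ \gamma'(\theta)&\gamma(\theta)\end{pmatrix}\begin{pmatrix}\cos2\theta&\sin2\theta\\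 \sin2\theta&-\cos2\theta\end{pmatrix}+\mathscr S(\theta)\left[\frac12\mathbf I-\frac12\begin{pmatrix}\cos2\theta&\sin2\theta\\ \sin2\theta&-\cos2\theta\end{pmatrix}\right].$$ Standing assumption: the stability function $\mathscr S$ is chosen such that for all nonzero $\mathbf v=|\mathbf v|(\cos\theta,\sin\theta)$ and $\mathbf w=|\mathbf w|(\cos\hat\theta,\sin\hat\theta)$, $$\frac1{|\mathbf v|}\big(\mathbf B(\theta)\mathbf w\big)\cdot(\mathbf w-\mathbf v)\ge|\mathbf w|\gamma(\hat\theta)-|\mathbf v|\gamma(\theta).$$ Further definitions: $$\mathbf K^{m+1}_{c_l,c_r}=\big\{\boldsymbol\psi\in[K(\mathbb I)]^2:\boldsymbol\psi(0)\cdot(\hat{\mathbf X}(c_l^{m+1})-\hat{\mathbf X}(c_l^m))^\perp=0,\ \boldsymbol\psi(1)\cdot(\hat{\mathbf X}(c_r^{m+1})-\hat{\mathbf X}(c_r^m))^\perp=0\big\},$$ $$\mathbf G(c_1,c_2)=\frac{\big(\hat{\mathbf X}(c_2)-\hat{\mathbf X}(c_1)\big)\int_{c_1}^{c_2}\hat x(c)\,dc}{|\hat{\mathbf X}(c_2)-\hat{\mathbf X}(c_1)|^2}\quad(\text{with the limiting value }\mathbf G(c,c)=\hat x(c)\hat{\mathbf X}_c(c)),$$ $$\mathbf f^{m+\frac12}=-\frac16\big[2r^m\partial_\rho\mathbf X^m+2r^{m+1}\partial_\rho\mathbf X^{m+1}+r^m\partial_\rho\mathbf X^{m+1}+r^{m+1}\partial_\rho\mathbf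 X^m\big]^\perp.$$ Energy-stable method: given $\mathbf X^m,c_l^m,c_r^m$, find $\mathbf X^{m+1}\in[K(\mathbb I)]^2$, $\mu^{m+1}\in K(\mathbb I)$ and $c_l^{m+1},c_r^{m+1}$ with $\mathbf X^{m+1}(0)=\hat{\mathbf X}(c_l^{m+1})$, $\mathbf X^{m+1}(1)=\hat{\mathbf X}(c_r^{m+1})$ such that for all $\varphi^h\in K(\mathbb I)$ and $\boldsymbol\psi^h=(\psi_1^h,\psi_2^h)\in\mathbf K^{m+1}_{c_l,c_r}$, $$\frac1{\Delta t_m}\big(\mathbf X^{m+1}-\mathbf X^m,\varphi^h\mathbf f^{m+\frac12}\big)-\big(r^m\partial_\rho\mu^{m+1},\partial_\rho\varphi^h|\partial_\rho\mathbf X^m|^{-1}\big)=0,$$ $$\begin{aligned}&\big(\mu^{m+1}\mathbf f^{m+\frac12},\boldsymbol\psi^h\big)+\big(\gamma(\theta^{m+1}),\psi_1^h|\partial_\rho\mathbf X^{m+1}|\big)+\big(r^m\mathbf B(\theta^m)\partial_\rho\mathbf X^{m+1},\partial_\rho\boldsymbol\psi^h|\partial_\rho\mathbf X^m|^{-1}\big)\\&+\frac1{\eta\Delta t_m}\big[(c_r^{m+1}-c_r^m)\mathbf G(c_r^m,c_r^{m+1})\cdot\boldsymbol\psi^h(1)+(c_l^{m+1}-c_l^m)\mathbf G(c_l^m,c_l^{m+1})\cdot\boldsymbol\psi^h(0)\big]\\&-\sigma\big[\mathbf G(c_r^m,c_r^{m+1})\cdot\boldsymbol\psi^h(1)-\mathbf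 G(c_l^m,c_l^{m+1})\cdot\boldsymbol\psi^h(0)\big]=0.\end{aligned}$$ Discrete energy: $W(\mathbf X^m)=2\pi\int_0^1r^m\gamma(\theta^m)|\partial_\rho\mathbf X^m|\,d\rho-2\pi\sigma\int_{c_l^m}^{c_r^m}\hat x(c)\,dc$. *)

(* Defs.v *)
From Stdlib Require Import Reals.
From Coquelicot Require Import Coquelicot.
Open Scope R_scope.

(* Plane vectors are pairs; [plus], [minus], [scal], [norm] on [vec] and [mat]
   are those of Coquelicot's product modules, and [norm] on [vec] is Euclidean. *)
Definition vec : Type := (R * R)%type.

Definition dot (u v : vec) : R := fst u * fst v + snd u * snd v.

Definition perp (v : vec) : vec := (snd v, - fst v).

(* A 2x2 matrix is the pair of its rows. *)
Definition mat : Type := (vec * vec)%type.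

Definition id_mat : mat := ((1, 0), (0, 1)).

Definition mat_vec (A : mat) (v : vec) : vec := (dot (fst A) v, dot (snd A) v).

Definition mat_mul (A B : mat) : mat :=
  let c1 : vec := (fst (fst B), fst (snd B)) in
  let c2 : vec := (snd (fst B), snd (snd B)) in
  ((dot (fst A) c1, dot (fst A) c2), (dot (snd A) c1, dot (snd A) c2)).

Definition dvec (X : R -> vec) (s : R) : vec :=
  (Derive (fun u => fst (X u)) s, Derive (fun u => snd (X u)) s).

(** * Finite elements on the uniform partition of [0,1] *)

Definition node (N j : nat) : R := INR j * / INR N.

(* Functions on [0,1] are total functions whose values outside [0,1] are
   never used. *)
Definition inK (N : nat) (u : R -> R) : Prop :=
  continuous_on (fun s => 0 <= s <= 1) u /\
  forall j, (j < N)%nat -> exists a b, forall s,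
    node N j <= s <= node N (S j) -> u s = a + b * s.

Definition inK2 (N : nat) (X : R -> vec) : Prop :=
  inK N (fun s => fst (X s)) /\ inK N (fun s => snd (X s)).

(* Derivatives of elements of [inK] are only meaningful away from the nodes, so
   pointwise conditions on them are imposed on the open cells; integrals do not
   see the nodes. *)
Definition in_cell (N j : nat) (s : R) : Prop :=
  (j < N)%nat /\ node N j < s < node N (S j).

(* The angle is determined up to a multiple of 2 PI on each cell; any choice
   is allowed. *)
Definition tangent_angle (N : nat) (X : R -> vec) (theta : R -> R) : Prop :=
  forall j, (j < N)%nat -> exists a, forall s, in_cell N j s ->
    theta s = a /\ dvec X s = scal (norm (dvec X s)) (cos a, sin a).

(** * Substrate *)

Definition interval_set (D : R -> Prop) : Prop :=
  forall a b c, D a -> D b -> a <= c <= b -> D c.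

(* The parameter domain [D] is an arbitrary interval (for example [0, +oo) for
   the flat substrate (c, 0)); smoothness on [D] means smoothness on a
   neighbourhood of [D]. *)
Definition substrate (D : R -> Prop) (Xh : R -> vec) : Prop :=
  interval_set D /\
  (forall c, D c -> locally c (fun s => forall n,
     ex_derive_n (fun u => fst (Xh u)) n s /\
     ex_derive_n (fun u => snd (Xh u)) n s)) /\
  (forall c, D c -> norm (dvec Xh c) = 1) /\
  (forall c, D c -> 0 <= fst (Xh c)).

Definition G (Xh : R -> vec) (c1 c2 : R) : vec :=
  if Req_EM_T c1 c2 then scal (fst (Xh c1)) (dvec Xh c1)
  else scal (RInt (fun c => fst (Xh c)) c1 c2 / norm (minus (Xh c2) (Xh c1)) ^ 2)
            (minus (Xh c2) (Xh c1)).

(* For distinct parameters the quotient defining [G] must not be 0 / 0, which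
   could only happen at a self-intersection of the substrate. *)
Definition G_defined (Xh : R -> vec) (c1 c2 : R) : Prop :=
  c1 <> c2 -> Xh c1 <> Xh c2.

(** * Surface energy *)

Definition surface_energy (gamma : R -> R) : Prop :=
  (forall x, 0 < gamma x) /\
  (forall x, gamma (x + 2 * PI) = gamma x) /\
  (forall x, gamma (- x) = gamma x) /\
  (forall x n, (n <= 2)%nat -> ex_derive_n gamma n x) /\
  (forall x, continuous (Derive_n gamma 2) x).

Definition refl_mat (th : R) : mat :=
  ((cos (2 * th), sin (2 * th)), (sin (2 * th), - cos (2 * th))).

Definition B (gamma S : R -> R) (th : R) : mat :=
  plus (mat_mul ((gamma th, - Derive gamma th), (Derive gamma th, gamma th))
                (refl_mat th))
       (scal (S th) (minus (scal (1 / 2) id_mat) (scal (1 / 2) (refl_mat th)))).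

Definition stability_function (gamma S : R -> R) : Prop :=
  forall (v w : vec) (th th' : R),
    v <> (0, 0) -> w <> (0, 0) ->
    v = scal (norm v) (cos th, sin th) ->
    w = scal (norm w) (cos th', sin th') ->
    1 / norm v * dot (mat_vec (B gamma S th) w) (minus w v)
    >= norm w * gamma th' - norm v * gamma th.

(** * Discrete curves and the scheme *)

Definition discrete_curve (N : nat) (D : R -> Prop) (Xh : R -> vec)
    (X : R -> vec) (cl cr : R) : Prop :=
  inK2 N X /\
  (forall s, 0 <= s <= 1 -> 0 <= fst (X s)) /\
  (forall j s, in_cell N j s -> 0 < norm (dvec X s)) /\
  D cl /\ D cr /\ X 0 = Xh cl /\ X 1 = Xh cr.

Definition test_space (N : nat) (Xh : R -> vec) (cl cr cl' cr' : R)
    (psi : R -> vec) : Prop :=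
  inK2 N psi /\
  dot (psi 0) (perp (minus (Xh cl') (Xh cl))) = 0 /\
  dot (psi 1) (perp (minus (Xh cr') (Xh cr))) = 0.

Definition f_half (X X' : R -> vec) (s : R) : vec :=
  let r := fst (X s) in
  let r' := fst (X' s) in
  scal (- (1 / 6)) (perp
    (plus (plus (plus (scal (2 * r) (dvec X s))
                      (scal (2 * r') (dvec X' s)))
                (scal r (dvec X' s)))
          (scal r' (dvec X s)))).

Definition first_equation (N : nat) (dt : R) (X X' : R -> vec) (mu : R -> R)
    : Prop :=
  forall phi : R -> R, inK N phi ->
    1 / dt * RInt (fun s => dot (minus (X' s) (X s))
                                (scal (phi s) (f_half X X' s))) 0 1
    - RInt (fun s => (fst (X s) * Derive mu s)
                     * (Derive phi s * / norm (dvec X s))) 0 1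
    = 0.

Definition second_equation (N : nat) (Xh : R -> vec) (gamma S : R -> R)
    (eta sigma dt : R) (X X' : R -> vec) (theta theta' : R -> R) (mu : R -> R)
    (cl cr cl' cr' : R) : Prop :=
  forall psi : R -> vec, test_space N Xh cl cr cl' cr' psi ->
    RInt (fun s => dot (scal (mu s) (f_half X X' s)) (psi s)) 0 1
    + RInt (fun s => gamma (theta' s) * (fst (psi s) * norm (dvec X' s))) 0 1
    + RInt (fun s => dot (scal (fst (X s))
                               (mat_vec (B gamma S (theta s)) (dvec X' s)))
                         (scal (/ norm (dvec X s)) (dvec psi s))) 0 1
    + 1 / (eta * dt) * ((cr' - cr) * dot (G Xh cr cr') (psi 1)
                        + (cl' - cl) * dot (G Xh cl cl') (psi 0))
    - sigma * (dot (G Xh cr cr') (psi 1) - dot (G Xh cl cl') (psi 0))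
    = 0.

(* [theta], [theta'] are tangent angles of [X] and [X']. *)
Definition energy_stable_step (N : nat) (D : R -> Prop) (Xh : R -> vec)
    (gamma S : R -> R) (eta sigma dt : R)
    (X : R -> vec) (theta : R -> R) (cl cr : R)
    (X' : R -> vec) (theta' : R -> R) (mu : R -> R) (cl' cr' : R) : Prop :=
  inK2 N X' /\ inK N mu /\ D cl' /\ D cr' /\
  X' 0 = Xh cl' /\ X' 1 = Xh cr' /\
  G_defined Xh cl cl' /\ G_defined Xh cr cr' /\
  first_equation N dt X X' mu /\
  second_equation N Xh gamma S eta sigma dt X X' theta theta' mu cl cr cl' cr'.

Definition W (Xh : R -> vec) (gamma : R -> R) (sigma : R)
    (X : R -> vec) (theta : R -> R) (cl cr : R) : R :=
  2 * PI * RInt (fun s => fst (X s) * gamma (theta s) * norm (dvec X s)) 0 1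
  - 2 * PI * sigma * RInt (fun c => fst (Xh c)) cl cr.

(* Main.v *)
Require Import Defs.
From Stdlib Require Import Reals Lra Lia.
From Coquelicot Require Import Coquelicot.
Open Scope R_scope.

(** The scheme is tested against its own solution.  Taking [mu] in the first
    equation turns the diffusion term into the integral of
    r mu_rho^2 / |X_rho|, which is nonnegative; the term
    (X' - X, mu f) that it balances is therefore nonnegative as well
    ([chemical_dissipation]).  Taking the displacement X' - X in the second
    equation is legitimate because both endpoints slide along chords of the
    substrate ([displacement_test_space]); it reproduces the same term
    (X' - X, mu f), together with two further groups of terms.

    The surface terms bound the growth of the surface energy from above.
    Pointwise, with v = X_rho and w = X'_rho, the stability condition on S says
    that r (B w . (w - v)) / |v| is at least r (gamma' |w| - gamma |v|), and
    adding gamma' (r' - r) |w| gives r' gamma' |w| - r gamma |v|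
    ([surface_energy_estimate]).

    The contact terms contain G(c, c') . (Xh(c') - Xh(c)), and G is built so
    that this is exactly the integral of xh from c to c' ([dot_G]).  Hence the
    sigma terms are the increment of the substrate energy
    ([substrate_energy_difference]), and the friction terms are nonnegative
    because xh >= 0 gives the integral the sign of c' - c
    ([contact_dissipation]).  Altogether the increment of W / (2 PI) is at most
    minus the sum of the two nonnegative dissipations.

    On each open cell the integrands to be estimated agree with polynomials,
    because derivatives and angles are constant there; their values at the
    nodes, where these quantities are arbitrary, do not affect the integrals. *)

(** * Integration cell by cell *)

Definition cellwise_constant {A : Type} (N : nat) (f : R -> A) : Prop :=
  forall j, (j < N)%nat -> exists a, forall s, in_cell N j s -> f s = a.

(** Agreement with a function that is continuous on the whole line, rather than
    mere continuity on the open cell, gives integrability up to the nodes. *)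
Definition cellwise_continuous (N : nat) (f : R -> R) : Prop :=
  forall j, (j < N)%nat -> exists g,
    (forall s, continuous g s) /\ forall s, in_cell N j s -> f s = g s.

Lemma cellwise_constant_comp {A C : Type} (N : nat) (F : A -> C) (f : R -> A) :
  cellwise_constant N f -> cellwise_constant N (fun s => F (f s)).
Proof.
  intros Hf j Hj. destruct (Hf j Hj) as [a Ha].
  exists (F a). intros s Hs. now rewrite (Ha s Hs).
Qed.

Lemma cellwise_constant_comp2 {A C E : Type} (N : nat) (F : A -> C -> E)
    (f : R -> A) (g : R -> C) :
  cellwise_constant N f -> cellwise_constant N g ->
  cellwise_constant N (fun s => F (f s) (g s)).
Proof.
  intros Hf Hg j Hj. destruct (Hf j Hj) as [a Ha], (Hg j Hj) as [c Hc].
  exists (F a c). intros s Hs. now rewrite (Ha s Hs), (Hc s Hs).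
Qed.

Lemma cellwise_constant_continuous (N : nat) (f : R -> R) :
  cellwise_constant N f -> cellwise_continuous N f.
Proof.
  intros Hf j Hj. destruct (Hf j Hj) as [a Ha].
  exists (fun _ => a). split; [|assumption].
  intros s. apply continuous_const.
Qed.

Lemma cellwise_continuous_mult (N : nat) (f g : R -> R) :
  cellwise_continuous N f -> cellwise_continuous N g ->
  cellwise_continuous N (fun s => f s * g s).
Proof.
  intros Hf Hg j Hj.
  destruct (Hf j Hj) as [a [Ca Ha]], (Hg j Hj) as [b [Cb Hb]].
  exists (fun s => a s * b s). split.
  - intros s. now apply (continuous_mult (K := R_AbsRing)).
  - intros s Hs. now rewrite (Ha s Hs), (Hb s Hs).
Qed.

Lemma cellwise_continuous_minus (N : nat) (f g : R -> R) :
  cellwise_continuous N f -> cellwise_continuous N g ->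
  cellwise_continuous N (fun s => f s - g s).
Proof.
  intros Hf Hg j Hj.
  destruct (Hf j Hj) as [a [Ca Ha]], (Hg j Hj) as [b [Cb Hb]].
  exists (fun s => a s - b s). split.
  - intros s. now apply (continuous_minus (V := R_NormedModule)).
  - intros s Hs. now rewrite (Ha s Hs), (Hb s Hs).
Qed.

Lemma node_lt_S (N j : nat) : (0 < N)%nat -> node N j < node N (S j).
Proof.
  intros HN. unfold node.
  apply Rmult_lt_compat_r; [apply Rinv_0_lt_compat, lt_0_INR, HN|].
  rewrite S_INR. lra.
Qed.

Lemma node_0 (N : nat) : node N 0 = 0.
Proof. unfold node. simpl. ring. Qed.

Lemma node_N (N : nat) : (0 < N)%nat -> node N N = 1.
Proof.
  intros HN. unfold node. apply Rinv_r. apply not_0_INR. lia.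
Qed.

Lemma in_cell_unit (N j : nat) (s : R) : in_cell N j s -> 0 <= s <= 1.
Proof.
  intros [Hj [Hl Hr]].
  assert (HN : 0 < / INR N) by (apply Rinv_0_lt_compat, lt_0_INR; lia).
  assert (H0 : 0 <= node N j) by (apply Rmult_le_pos; [apply pos_INR|lra]).
  assert (H1 : node N (S j) <= node N N)
    by (apply Rmult_le_compat_r; [lra|apply le_INR; lia]).
  rewrite node_N in H1 by lia. lra.
Qed.

Lemma ex_RInt_cell (N k : nat) (f : R -> R) :
  cellwise_continuous N f -> (k < N)%nat ->
  ex_RInt f (node N k) (node N (S k)).
Proof.
  intros Hf Hk. assert (Hlt : node N k < node N (S k)) by (apply node_lt_S; lia).
  destruct (Hf k Hk) as [g [Cg Hg]].
  apply ex_RInt_ext with g.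
  - rewrite Rmin_left, Rmax_right by lra.
    intros s Hs. symmetry. apply Hg. split; assumption.
  - apply (ex_RInt_continuous (V := R_CompleteNormedModule)).
    intros s _. apply Cg.
Qed.

Lemma ex_RInt_to_node (N k : nat) (f : R -> R) :
  cellwise_continuous N f -> (k <= N)%nat -> ex_RInt f 0 (node N k).
Proof.
  intros Hf. induction k as [|k IH]; intros Hk.
  - rewrite node_0. apply ex_RInt_point.
  - apply ex_RInt_Chasles with (node N k); [apply IH; lia|].
    now apply ex_RInt_cell.
Qed.

Lemma ex_RInt_cellwise (N : nat) (f : R -> R) :
  (0 < N)%nat -> cellwise_continuous N f -> ex_RInt f 0 1.
Proof.
  intros HN Hf. rewrite <- (node_N N HN). now apply ex_RInt_to_node.
Qed.

(** The sign is only required inside the cells: at a node [Derive] and the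
    tangent angle may take any value, so pointwise bounds can fail there. *)
Lemma RInt_ge_0_cellwise (N : nat) (f : R -> R) :
  (0 < N)%nat -> cellwise_continuous N f ->
  (forall j s, in_cell N j s -> 0 <= f s) -> 0 <= RInt f 0 1.
Proof.
  intros HN Hf Hpos.
  assert (H : forall k, (k <= N)%nat -> 0 <= RInt f 0 (node N k)).
  { induction k as [|k IH]; intros Hk.
    { rewrite node_0, RInt_point. apply Rle_refl. }
    assert (Hcell := ex_RInt_cell N k f Hf Hk).
    rewrite <- (RInt_Chasles f 0 (node N k) (node N (S k)));
      [|apply ex_RInt_to_node; [assumption|lia]|assumption].
    apply Rplus_le_le_0_compat; [apply IH; lia|].
    apply RInt_ge_0; [left; now apply node_lt_S|assumption|].
    intros s Hs. apply (Hpos k). split; assumption. }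
  rewrite <- (node_N N HN). now apply H.
Qed.

(** * Finite element functions on the cells *)

Lemma inK_cellwise_continuous (N : nat) (u : R -> R) :
  inK N u -> cellwise_continuous N u.
Proof.
  intros [_ Hu] j Hj. destruct (Hu j Hj) as [a [b Hab]].
  exists (fun s => a + b * s). split.
  - intros s. apply (ex_derive_continuous (V := R_NormedModule)). auto_derive.
    exact I.
  - intros s [_ Hs]. apply Hab. lra.
Qed.

Lemma inK_is_derive (N : nat) (u : R -> R) (j : nat) :
  inK N u -> (j < N)%nat ->
  exists b, forall s, in_cell N j s -> is_derive u s b.
Proof.
  intros [_ Hu] Hj. destruct (Hu j Hj) as [a [b Hab]].
  exists b. intros s [_ Hs].
  apply is_derive_ext_loc with (fun x => a + b * x).
  - assert (Hloc : locally s (fun x => node N j < x < node N (S j))).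
    { apply (open_and (fun x => node N j < x) (fun x => x < node N (S j)));
        [apply open_gt|apply open_lt|exact Hs]. }
    revert Hloc. apply filter_imp.
    intros x Hx. symmetry. apply Hab. lra.
  - auto_derive; [exact I|ring].
Qed.

Lemma Derive_cellwise_constant (N : nat) (u : R -> R) :
  inK N u -> cellwise_constant N (Derive u).
Proof.
  intros Hu j Hj. destruct (inK_is_derive N u j Hu Hj) as [b Hb].
  exists b. intros s Hs. now apply is_derive_unique, Hb.
Qed.

Lemma dvec_cellwise_constant (N : nat) (X : R -> vec) :
  inK2 N X -> cellwise_constant N (dvec X).
Proof.
  intros [H1 H2]. apply (cellwise_constant_comp2 N pair);
    now apply Derive_cellwise_constant.
Qed.

Lemma tangent_angle_cellwise_constant (N : nat) (X : R -> vec) (theta : R -> R) :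
  tangent_angle N X theta -> cellwise_constant N theta.
Proof.
  intros H j Hj. destruct (H j Hj) as [a Ha].
  exists a. intros s Hs. now apply Ha.
Qed.

Lemma inK_minus (N : nat) (u v : R -> R) :
  inK N u -> inK N v -> inK N (fun s => u s - v s).
Proof.
  intros [Cu Au] [Cv Av]. split.
  - intros s Hs.
    apply (filterlim_comp_2 (G := locally (u s)) (H := locally (- v s))
             u (fun x => - v x) Rplus).
    + now apply Cu.
    + eapply filterlim_comp; [now apply Cv|].
      apply (filterlim_opp (V := R_NormedModule)).
    + apply (filterlim_plus (V := R_NormedModule)).
  - intros j Hj.
    destruct (Au j Hj) as [a [b Hab]], (Av j Hj) as [c [d Hcd]].
    exists (a - c), (b - d). intros s Hs.
    rewrite (Hab s Hs), (Hcd s Hs). ring.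
Qed.

Definition displacement (X X' : R -> vec) : R -> vec :=
  fun s => minus (X' s) (X s).

Lemma inK2_displacement (N : nat) (X X' : R -> vec) :
  inK2 N X -> inK2 N X' -> inK2 N (displacement X X').
Proof.
  intros [H1 H2] [H1' H2']. split; now apply inK_minus.
Qed.

Lemma dvec_displacement (N : nat) (X X' : R -> vec) (j : nat) (s : R) :
  inK2 N X -> inK2 N X' -> in_cell N j s ->
  dvec (displacement X X') s = minus (dvec X' s) (dvec X s).
Proof.
  intros [H1 H2] [H1' H2'] Hs.
  assert (Hex : forall u, inK N u -> ex_derive u s).
  { intros u Hu. destruct (inK_is_derive N u j Hu (proj1 Hs)) as [b Hb].
    exists b. now apply Hb. }
  unfold dvec. apply injective_projections; simpl;
    apply Derive_minus; now apply Hex.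
Qed.

(** * Plane vectors *)

Lemma norm_sqr (v : vec) : norm v ^ 2 = dot v v.
Proof.
  change (norm v) with (sqrt (Rabs (fst v) ^ 2 + Rabs (snd v) ^ 2)).
  rewrite (pow2_abs (fst v)), (pow2_abs (snd v)), pow2_sqrt.
  - unfold dot. ring.
  - apply Rplus_le_le_0_compat; apply pow2_ge_0.
Qed.

Lemma norm_gt_0_neq_0 (v : vec) : 0 < norm v -> v <> (0, 0).
Proof.
  intros Hv ->. assert (H := norm_sqr (0, 0)).
  unfold dot in H. simpl in H, Hv. nra.
Qed.

Lemma dot_scal_l (a : R) (u v : vec) : dot (scal a u) v = a * dot u v.
Proof.
  unfold dot. simpl. unfold scal; simpl; unfold mult; simpl. ring.
Qed.

Lemma dot_comm (u v : vec) : dot u v = dot v u.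
Proof. unfold dot. ring. Qed.

Lemma dot_scal_r (a : R) (u v : vec) : dot u (scal a v) = a * dot u v.
Proof. now rewrite dot_comm, dot_scal_l, dot_comm. Qed.

Lemma dot_perp (v : vec) : dot v (perp v) = 0.
Proof. unfold dot, perp. simpl. ring. Qed.

(** * Contact points on the substrate *)

(** The factor |Xh(c2) - Xh(c1)|^2 in the denominator of [G] cancels, so the
    contact terms tested with the displacement measure the substrate energy
    without any discretisation error. *)
Lemma dot_G (Xh : R -> vec) (c1 c2 : R) :
  G_defined Xh c1 c2 ->
  dot (G Xh c1 c2) (minus (Xh c2) (Xh c1)) = RInt (fun c => fst (Xh c)) c1 c2.
Proof.
  intros HG. unfold G. destruct (Req_EM_T c1 c2) as [<-|Hne].
  - rewrite RInt_point, minus_eq_zero.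
    change (dot (scal (fst (Xh c1)) (dvec Xh c1)) (0, 0) = 0).
    unfold dot. simpl fst; simpl snd. ring.
  - set (v := minus (Xh c2) (Xh c1)).
    assert (Hv : dot v v <> 0).
    { intros H0. apply (HG Hne).
      unfold dot in H0.
      change (fst v) with (fst (Xh c2) - fst (Xh c1)) in H0.
      change (snd v) with (snd (Xh c2) - snd (Xh c1)) in H0.
      apply Rplus_sqr_eq_0 in H0 as [H1 H2].
      apply injective_projections; lra. }
    set (I := RInt _ c1 c2). rewrite norm_sqr.
    transitivity (I / dot v v * dot v v).
    + apply dot_scal_l.
    + now field.
Qed.

Lemma substrate_ex_RInt (D : R -> Prop) (Xh : R -> vec) (a b : R) :
  substrate D Xh -> D a -> D b -> ex_RInt (fun c => fst (Xh c)) a b.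
Proof.
  intros [HD [Hsm _]] Ha Hb.
  apply (ex_RInt_continuous (V := R_CompleteNormedModule)). intros c Hc.
  assert (Dc : D c).
  { destruct (Rle_dec a b).
    - rewrite Rmin_left, Rmax_right in Hc by lra. now apply (HD a b).
    - rewrite Rmin_right, Rmax_left in Hc by lra. now apply (HD b a). }
  apply (ex_derive_continuous (V := R_NormedModule)).
  apply (locally_singleton _ _ (Hsm c Dc) 1%nat).
Qed.

(** As xh >= 0, its integral from [a] to [b] has the sign of [b - a]: friction
    at a contact point can only remove energy, whichever way it moves. *)
Lemma contact_dissipation (D : R -> Prop) (Xh : R -> vec) (a b : R) :
  substrate D Xh -> D a -> D b ->
  0 <= (b - a) * RInt (fun c => fst (Xh c)) a b.
Proof.
  intros HXh Ha Hb.
  assert (Hpos : forall a b, D a -> D b -> a <= b ->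
                   0 <= RInt (fun c => fst (Xh c)) a b).
  { clear a b Ha Hb. intros a b Ha Hb Hab.
    apply RInt_ge_0; [assumption|now apply (substrate_ex_RInt D)|].
    intros c Hc. destruct HXh as [HD [_ [_ Hx]]].
    apply Hx, (HD a b); [assumption|assumption|lra]. }
  destruct (Rle_dec a b) as [Hab|Hab].
  - apply Rmult_le_pos; [lra|now apply Hpos].
  - rewrite <- (opp_RInt_swap (fun c => fst (Xh c)))
      by now apply (substrate_ex_RInt D).
    change opp with Ropp.
    replace ((b - a) * - _) with ((a - b) * RInt (fun c => fst (Xh c)) b a) by ring.
    apply Rmult_le_pos; [lra|apply Hpos; [assumption|assumption|lra]].
Qed.

(** The integral from [cl] to [cr'] can be split at [cl'] or at [cr]; this holds
    for the endpoints in any order. *)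
Lemma substrate_energy_difference (D : R -> Prop) (Xh : R -> vec)
    (cl cr cl' cr' : R) :
  substrate D Xh -> D cl -> D cr -> D cl' -> D cr' ->
  RInt (fun c => fst (Xh c)) cl' cr' - RInt (fun c => fst (Xh c)) cl cr
  = RInt (fun c => fst (Xh c)) cr cr' - RInt (fun c => fst (Xh c)) cl cl'.
Proof.
  intros HXh Hl Hr Hl' Hr'.
  assert (Hex : forall a b, D a -> D b -> ex_RInt (fun c => fst (Xh c)) a b)
    by (intros a b; now apply substrate_ex_RInt).
  assert (H1 := RInt_Chasles (fun c => fst (Xh c)) cl cl' cr'
                  (Hex _ _ Hl Hl') (Hex _ _ Hl' Hr')).
  assert (H2 := RInt_Chasles (fun c => fst (Xh c)) cl cr cr'
                  (Hex _ _ Hl Hr) (Hex _ _ Hr Hr')).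
  change plus with Rplus in H1, H2. lra.
Qed.

(** * Energy estimates *)

(** The stability condition controls the anisotropic part of the increment
    with the old weight r; the term gamma' (r' - r) |X'_rho| corrects the weight
    from r to r' exactly, so the defect between the two sides is the integral of
    r times the slack in the stability condition. *)
Lemma surface_energy_estimate (N : nat) (gamma S : R -> R)
    (X X' : R -> vec) (theta theta' : R -> R) :
  (0 < N)%nat -> stability_function gamma S ->
  inK2 N X -> inK2 N X' ->
  (forall s, 0 <= s <= 1 -> 0 <= fst (X s)) ->
  (forall j s, in_cell N j s -> 0 < norm (dvec X s)) ->
  (forall j s, in_cell N j s -> 0 < norm (dvec X' s)) ->
  tangent_angle N X theta -> tangent_angle N X' theta' ->
  let V := displacement X X' in
  RInt (fun s => fst (X' s) * gamma (theta' s) * norm (dvec X' s)) 0 1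
  - RInt (fun s => fst (X s) * gamma (theta s) * norm (dvec X s)) 0 1
  <= RInt (fun s => gamma (theta' s) * (fst (V s) * norm (dvec X' s))) 0 1
     + RInt (fun s => dot (scal (fst (X s))
                                (mat_vec (B gamma S (theta s)) (dvec X' s)))
                          (scal (/ norm (dvec X s)) (dvec V s))) 0 1.
Proof.
  intros HN HS KX KX' Hr HX HX' Hth Hth' V.
  (* [A - (e' - e)] is the slack in the stability condition. *)
  pose (A := fun s => dot (mat_vec (B gamma S (theta s)) (dvec X' s))
                          (scal (/ norm (dvec X s)) (dvec V s))).
  pose (e := fun s => gamma (theta s) * norm (dvec X s)).
  pose (e' := fun s => gamma (theta' s) * norm (dvec X' s)).
  assert (CX := dvec_cellwise_constant N X KX).
  assert (CX' := dvec_cellwise_constant N X' KX').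
  assert (CV := dvec_cellwise_constant N V (inK2_displacement N X X' KX KX')).
  assert (Cth := tangent_angle_cellwise_constant N X theta Hth).
  assert (Cth' := tangent_angle_cellwise_constant N X' theta' Hth').
  assert (CA : cellwise_constant N A).
  { apply (cellwise_constant_comp2 N dot).
    - now apply (cellwise_constant_comp2 N
                   (fun th w => mat_vec (B gamma S th) w)).
    - now apply (cellwise_constant_comp2 N
                   (fun v w : vec => scal (/ norm v) w : vec)). }
  assert (Ce : cellwise_constant N e).
  { now apply (cellwise_constant_comp2 N (fun th (v : vec) => gamma th * norm v)). }
  assert (Ce' : cellwise_constant N e').
  { now apply (cellwise_constant_comp2 N (fun th (v : vec) => gamma th * norm v)). }
  assert (Cr := inK_cellwise_continuous N _ (proj1 KX)).
  assert (Cr' := inK_cellwise_continuous N _ (proj1 KX')).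
  assert (Cmult : forall f g, cellwise_continuous N f -> cellwise_constant N g ->
                    cellwise_continuous N (fun s => f s * g s)).
  { intros f g Hf Hg. apply cellwise_continuous_mult; [assumption|].
    now apply cellwise_constant_continuous. }
  assert (CE : cellwise_continuous N (fun s => fst (X s) * (A s - (e' s - e s)))).
  { apply Cmult; [assumption|].
    apply (cellwise_constant_comp2 N (fun a b => a - b)); [assumption|].
    now apply (cellwise_constant_comp2 N (fun a b => a - b)). }
  assert (HE : 0 <= RInt (fun s => fst (X s) * (A s - (e' s - e s))) 0 1).
  { apply (RInt_ge_0_cellwise N); [assumption|assumption|].
    intros j s Hs. apply Rmult_le_pos.
    - apply Hr. apply (in_cell_unit N j s Hs).
    - destruct (Hth j (proj1 Hs)) as [a Ha], (Hth' j (proj1 Hs)) as [a' Ha'].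
      destruct (Ha s Hs) as [Eth Ev], (Ha' s Hs) as [Eth' Ew].
      assert (Hv := HX j s Hs). assert (Hw := HX' j s Hs).
      assert (Hst := HS (dvec X s) (dvec X' s) a a'
                       (norm_gt_0_neq_0 _ Hv) (norm_gt_0_neq_0 _ Hw) Ev Ew).
      unfold A, e, e', V. rewrite (dvec_displacement N X X' j s KX KX' Hs), Eth, Eth'.
      rewrite dot_scal_r. unfold Rdiv in Hst. lra. }
  replace (RInt _ 0 1) with (RInt (fun s => fst (X' s) * e' s) 0 1)
    by (apply RInt_ext; intros s _; symmetry; apply Rmult_assoc).
  replace (RInt (fun s => fst (X s) * gamma _ * _) 0 1)
    with (RInt (fun s => fst (X s) * e s) 0 1)
    by (apply RInt_ext; intros s _; symmetry; apply Rmult_assoc).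
  replace (RInt (fun s => gamma (theta' s) * _) 0 1)
    with (RInt (fun s => (fst (X' s) - fst (X s)) * e' s) 0 1).
  2:{ apply RInt_ext. intros s _. unfold e'.
      change ((fst (X' s) - fst (X s)) * (gamma (theta' s) * norm (dvec X' s))
        = gamma (theta' s) * ((fst (X' s) - fst (X s)) * norm (dvec X' s))).
      ring. }
  replace (RInt (fun s => dot _ _) 0 1) with (RInt (fun s => fst (X s) * A s) 0 1)
    by (apply RInt_ext; intros s _; symmetry; apply dot_scal_l).
  assert (I1 := ex_RInt_cellwise N _ HN (Cmult _ _ Cr' Ce')).
  assert (I2 := ex_RInt_cellwise N _ HN (Cmult _ _ Cr Ce)).
  assert (I3 := ex_RInt_cellwise N _ HN
                  (Cmult _ _ (cellwise_continuous_minus N _ _ Cr' Cr) Ce')).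
  assert (I4 := ex_RInt_cellwise N _ HN (Cmult _ _ Cr CA)).
  assert (Hlin := is_RInt_unique _ _ _ _ (is_RInt_minus _ _ _ _ _ _
    (is_RInt_plus _ _ _ _ _ _ (RInt_correct _ _ _ I3) (RInt_correct _ _ _ I4))
    (is_RInt_minus _ _ _ _ _ _ (RInt_correct _ _ _ I1) (RInt_correct _ _ _ I2)))).
  rewrite (RInt_ext _ (fun s => fst (X s) * (A s - (e' s - e s)))) in Hlin.
  2:{ intros s _.
      change (((fst (X' s) - fst (X s)) * e' s + fst (X s) * A s)
              - (fst (X' s) * e' s - fst (X s) * e s)
              = fst (X s) * (A s - (e' s - e s))).
      ring. }
  rewrite Hlin in HE. unfold minus, plus, opp in HE. simpl in HE. lra.
Qed.

(** Testing with [mu] itself equates 1 / dt times this integral with the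
    integral of r mu_rho^2 / |X_rho|. *)
Lemma chemical_dissipation (N : nat) (dt : R) (X X' : R -> vec) (mu : R -> R) :
  (0 < N)%nat -> 0 < dt -> inK2 N X -> inK N mu ->
  (forall s, 0 <= s <= 1 -> 0 <= fst (X s)) ->
  (forall j s, in_cell N j s -> 0 < norm (dvec X s)) ->
  first_equation N dt X X' mu ->
  0 <= RInt (fun s => dot (scal (mu s) (f_half X X' s)) (displacement X X' s)) 0 1.
Proof.
  intros HN Hdt KX Kmu Hr HX Heq.
  specialize (Heq mu Kmu).
  assert (Hdiss : 0 <= RInt (fun s => (fst (X s) * Derive mu s)
                     * (Derive mu s * / norm (dvec X s))) 0 1).
  { assert (Cmu := Derive_cellwise_constant N mu Kmu).
    apply (RInt_ge_0_cellwise N); [assumption| |].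
    - repeat apply cellwise_continuous_mult.
      + exact (inK_cellwise_continuous N _ (proj1 KX)).
      + now apply cellwise_constant_continuous.
      + now apply cellwise_constant_continuous.
      + apply cellwise_constant_continuous.
        apply (cellwise_constant_comp N (fun v : vec => / norm v)).
        now apply dvec_cellwise_constant.
    - intros j s Hs.
      assert (H1 := Hr s (in_cell_unit N j s Hs)).
      assert (H2 := Rinv_0_lt_compat _ (HX j s Hs)).
      enough (0 <= fst (X s) * / norm (dvec X s) * (Derive mu s)²)
        by (unfold Rsqr in *; lra).
      apply Rmult_le_pos; [apply Rmult_le_pos; lra|apply Rle_0_sqr]. }
  rewrite (RInt_ext _ (fun s => dot (scal (mu s) (f_half X X' s))
                                 (displacement X X' s))) in Heq.
  2:{ intros s _. rewrite dot_scal_r, dot_scal_l, dot_comm. reflexivity. }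
  apply Rmult_le_reg_l with (1 / dt).
  - apply Rdiv_lt_0_compat; lra.
  - lra.
Qed.

(** At each end the displacement is the chord of the substrate itself, to whose
    normal the test functions have to be orthogonal. *)
Lemma displacement_test_space (N : nat) (Xh X X' : R -> vec) (cl cr cl' cr' : R) :
  inK2 N X -> inK2 N X' ->
  X 0 = Xh cl -> X 1 = Xh cr -> X' 0 = Xh cl' -> X' 1 = Xh cr' ->
  test_space N Xh cl cr cl' cr' (displacement X X').
Proof.
  intros KX KX' H0 H1 H0' H1'. split; [now apply inK2_displacement|].
  unfold displacement. rewrite H0, H1, H0', H1'. split; apply dot_perp.
Qed.

Theorem theorem4p2
  (D : R -> Prop) (Xh : R -> vec) (HXh : substrate D Xh)
  (gamma S : R -> R) (Hgamma : surface_energy gamma)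
  (HS : stability_function gamma S)
  (eta sigma : R) (Heta : 0 < eta)
  (N : nat) (HN : (0 < N)%nat)
  (M : nat) (t : nat -> R) (Ht : forall m, (m < M)%nat -> 0 < t (m + 1)%nat - t m)
  (X : nat -> R -> vec) (theta mu : nat -> R -> R) (cl cr : nat -> R)
  (HX : forall m, (m <= M)%nat -> discrete_curve N D Xh (X m) (cl m) (cr m))
  (Htheta : forall m, (m <= M)%nat -> tangent_angle N (X m) (theta m))
  (m : nat) (Hm : (m < M)%nat)
  (Hsol : energy_stable_step N D Xh gamma S eta sigma (t (m + 1)%nat - t m)
            (X m) (theta m) (cl m) (cr m)
            (X (m + 1)%nat) (theta (m + 1)%nat) (mu (m + 1)%nat)
            (cl (m + 1)%nat) (cr (m + 1)%nat)) :
  W Xh gamma sigma (X (m + 1)%nat) (theta (m + 1)%nat)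
    (cl (m + 1)%nat) (cr (m + 1)%nat)
  - W Xh gamma sigma (X m) (theta m) (cl m) (cr m) <= 0.
Proof.
  assert (Hm' : (m + 1 <= M)%nat) by lia.
  assert (Hdt := Ht m Hm).
  destruct (HX m) as [KX [Hr [Hreg [Dl [Dr [X0 X1]]]]]]; [lia|].
  destruct (HX (m + 1)%nat Hm') as [KX' [_ [Hreg' _]]].
  destruct Hsol as [_ [Kmu [Dl' [Dr' [X0' [X1' [Gl [Gr [Eq1 Eq2]]]]]]]]].
  assert (Hthm := Htheta m (Nat.lt_le_incl _ _ Hm)).
  assert (Hest := surface_energy_estimate N gamma S _ _ _ _ HN HS KX KX' Hr
                    Hreg Hreg' Hthm (Htheta _ Hm')).
  assert (Hmu := chemical_dissipation N _ _ _ _ HN Hdt KX Kmu Hr Hreg Eq1).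
  specialize (Eq2 _ (displacement_test_space N Xh _ _ _ _ _ _ KX KX'
                       X0 X1 X0' X1')).
  cbv zeta in Hest.
  set (V := displacement _ _) in *.
  assert (V0 : V 0 = minus (Xh (cl (m + 1)%nat)) (Xh (cl m)))
    by (unfold V, displacement; now rewrite X0, X0').
  assert (V1 : V 1 = minus (Xh (cr (m + 1)%nat)) (Xh (cr m)))
    by (unfold V, displacement; now rewrite X1, X1').
  rewrite V0, V1, !dot_G in Eq2 by assumption.
  assert (Hcl := contact_dissipation D Xh _ _ HXh Dl Dl').
  assert (Hcr := contact_dissipation D Xh _ _ HXh Dr Dr').
  assert (Hsub := substrate_energy_difference D Xh _ _ _ _ HXh Dl Dr Dl' Dr').
  assert (Hc := Rmult_le_pos (1 / (eta * (t (m + 1)%nat - t m))) _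
    (Rlt_le _ _ (Rdiv_lt_0_compat _ _ Rlt_0_1 (Rmult_lt_0_compat _ _ Heta Hdt)))
    (Rplus_le_le_0_compat _ _ Hcr Hcl)).
  unfold W.
  set (E' := RInt (fun s => fst (X (m + 1)%nat s) * gamma _ * _) 0 1) in *.
  set (E := RInt (fun s => fst (X m s) * gamma _ * _) 0 1) in *.
  assert (Hdec : E' - E
    <= sigma * (RInt (fun c => fst (Xh c)) (cl (m + 1)%nat) (cr (m + 1)%nat)
                - RInt (fun c => fst (Xh c)) (cl m) (cr m))).
  { rewrite Hsub. lra. }
  assert (HPI := PI_RGT_0). nra.
Qed.
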